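(* Let $E,F,G$ be real Banach lattices and let $S_1:E\to F$ and $S_2:F\to G$ be positive operators. If each $S_i$ ($i=1,2$) is dominated by a DW-compact positive operator (i.e. $0\le S_1\le T_1$ and $0\le S_2\le T_2$ for some DW-compact operators $T_1:E\to F$ and $T_2:F\to G$), then $S_2S_1$ is DW-compact. In particular, if a positive operator $S$ on a Banach lattice is dominated by a DW-compact operator, then $S^2$ is a DW-compact operator.
   Context: For a subset $A$ of a Banach lattice $E$, $Sol(A)=\{y\in E: |y|\le |x| \text{ for some } x\in A\}$. A bounded subset $A$ of $E$ is disjointly weakly compact if every disjoint sequence in $Sol(A)$ converges weakly to zero. A bounded linear operator $T$ from $E$ to a Banach space is DW-compact if $T(A)$ is relatively (norm) compact for each disjointly weakly compact $A\subset E$. *)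

(* Defs.v *)
From HB Require Import structures.
From mathcomp Require Import all_boot all_order all_algebra.
From mathcomp Require Import all_classical all_reals all_analysis.

Set Implicit Arguments.
Unset Strict Implicit.
Unset Printing Implicit Defensive.

Import Order.TTheory GRing.Theory Num.Theory.
Import numFieldNormedType.Exports.

Local Open Scope classical_set_scope.
Local Open Scope ring_scope.

(* Hierarchy Builder rejects a join of CompleteNormedModule and Order.Lattice
   declared after Num.RealDomain, so the order and the lattice operations are
   fields here; the latticeType instance below gives the library's order. *)
HB.mixin Record CompleteNormedModule_isBanachLattice (R : realType) E
    & CompleteNormedModule R E := {
  bl_le : rel E;
  bl_meet : E -> E -> E;
  bl_join : E -> E -> E;
  bl_le_refl : reflexive bl_le;
  bl_le_anti : antisymmetric bl_le;
  bl_le_trans : transitive bl_le;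
  bl_lexI : forall x y z, bl_le x (bl_meet y z) = bl_le x y && bl_le x z;
  bl_leUx : forall x y z, bl_le (bl_join x y) z = bl_le x z && bl_le y z;
  bl_leD2r : forall z x y : E, bl_le x y -> bl_le (x + z) (y + z);
  bl_scale_ge0 : forall (a : R) (x : E),
    0 <= a -> bl_le 0 x -> bl_le 0 (a *: x);
  bl_le_norm : forall x y : E,
    bl_le (bl_join x (- x)) (bl_join y (- y)) -> `|x| <= `|y|
}.

#[short(type="banachLatticeType")]
HB.structure Definition BanachLattice (R : realType) :=
  {E of CompleteNormedModule R E
      & CompleteNormedModule_isBanachLattice R E}.

HB.instance Definition _ (R : realType) (E : banachLatticeType R) :=
  Order.Le_isPOrder.Build ring_display (BanachLattice.sort E)
    (@bl_le_refl R E) (@bl_le_anti R E) (@bl_le_trans R E).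

HB.instance Definition _ (R : realType) (E : banachLatticeType R) :=
  Order.POrder_MeetJoin_isLattice.Build ring_display (BanachLattice.sort E)
    (@bl_lexI R E) (@bl_leUx R E).

Section BanachLatticeTheory.
Context {R : realType} {E : banachLatticeType R}.

(* The modulus is an element of E; `|x| is the norm, a scalar. *)
Definition modulus (x : E) : E := Order.join x (- x).

Lemma banach_lattice_leD2r (z x y : E) : x <= y -> x + z <= y + z.
Proof. exact: bl_leD2r. Qed.

Lemma banach_lattice_scale_ge0 (a : R) (x : E) :
  0 <= a -> 0 <= x -> 0 <= a *: x.
Proof. exact: bl_scale_ge0. Qed.

Lemma banach_lattice_le_norm (x y : E) :
  modulus x <= modulus y -> `|x| <= `|y|.
Proof. exact: bl_le_norm. Qed.

Definition Sol (A : set E) : set E :=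
  [set y | exists2 x, A x & modulus y <= modulus x].

Definition disjoint_seq (y : nat -> E) :=
  forall m n, m <> n -> Order.meet (modulus (y m)) (modulus (y n)) = 0.

End BanachLatticeTheory.

Definition weak_cvg {R : realType} {E : normedModType R}
    (y : nat -> E) (l : E) :=
  forall f : {linear E -> R^o}, continuous f -> f (y n) @[n --> \oo] --> f l.

Definition disjointly_weakly_compact {R : realType} {E : banachLatticeType R}
    (A : set E) :=
  bounded_set A /\
  forall y : nat -> E, (forall n, Sol A (y n)) -> disjoint_seq y ->
    weak_cvg y 0.

Definition bounded_operator {R : realType} {E F : normedModType R}
    (T : {linear E -> F}) :=
  exists M : R, forall x, `|T x| <= M * `|x|.

(* Relative compactness in the norm topology is the library's precompact:
   compact closure, by precompactE. *)
Definition DW_compact {R : realType} {E : banachLatticeType R}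
    {X : completeNormedModType R} (T : {linear E -> X}) :=
  bounded_operator T /\
  forall A : set E, disjointly_weakly_compact A -> precompact (T @` A).

Definition operator_le {R : realType} {E F : banachLatticeType R}
    (S T : {linear E -> F}) :=
  forall x, 0 <= x -> S x <= T x.

Definition positive_operator {R : realType} {E F : banachLatticeType R}
    (T : {linear E -> F}) :=
  forall x, 0 <= x -> 0 <= T x.

(* Main.v *)
(* For a disjointly weakly compact set A, disjoint positive sequences of Sol A
   are weakly null, so a positive DW-compact T1 sends them to norm null
   sequences.  Hence T1, and with it S1 <= T1, is uniformly small on the parts
   (x - u)^+ of the positive x in Sol A, for a suitable u >= 0, and it suffices
   to show that S2 S1 [0, u] is totally bounded.

   Order intervals are disjointly weakly compact, so T1 [0, u] and
   T2 [0, S1 u] are totally bounded.  On the latter set of positive vectors the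
   norm is controlled by a single positive functional psi, and
   |S2 S1 x - S2 S1 y| <= T2 |S1 x - S1 y|; therefore S1 [0, u] need only be
   totally bounded for the seminorm phi(|.|) with phi = psi o T2.  That is
   Dodds-Fremlin domination with values in an AL-space.  Instead of a
   Radon-Nikodym density of S1 with respect to T1, it is obtained here from
   partitions u = \sum a_i, phi = \sum b_j almost maximizing the energy
   \sum b_j(S1 a_i)^2 / b_j(T1 a_i). *)

Require Import Defs.
From HB Require Import structures.
From mathcomp Require Import all_boot all_order all_algebra.
From mathcomp Require Import all_classical all_reals all_analysis.
From mathcomp Require Import finmap lra ring.

Set Implicit Arguments.
Unset Strict Implicit.
Unset Printing Implicit Defensive.

Import Order.TTheory GRing.Theory Num.Theory.
Import numFieldNormedType.Exports.

Local Open Scope classical_set_scope.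
Local Open Scope ring_scope.

(** * Vector lattice identities *)

Section RieszSpace.
Context {R : realType} {E : banachLatticeType R}.
Implicit Types (x y z a b : E) (r s : R).

Definition pos x : E := Order.join x 0.

Lemma bl_lerD x y z t : x <= y -> z <= t -> x + z <= y + t :> E.
Proof.
move=> xy zt; apply: le_trans (banach_lattice_leD2r z xy) _.
by rewrite ![y + _]addrC; exact: banach_lattice_leD2r.
Qed.

Lemma bl_subr_ge0 x y : (0 <= y - x) = (x <= y).
Proof.
apply/idP/idP => /banach_lattice_leD2r; first by move=> /(_ x); rewrite add0r subrK.
by move=> /(_ (- x)); rewrite subrr.
Qed.

Lemma bl_lerN2 x y : (- x <= - y) = (y <= x).
Proof. by rewrite -[LHS]bl_subr_ge0 opprK addrC bl_subr_ge0. Qed.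

Lemma bl_lerDl x y : 0 <= y -> x <= x + y.
Proof. by move=> y0; rewrite -{1}[x]addr0; exact: bl_lerD. Qed.

Lemma bl_gerDl x y : 0 <= y -> x - y <= x.
Proof. by move=> y0; rewrite -bl_subr_ge0 opprB addrC subrK. Qed.

Lemma bl_lerBlDr x y z : (x - y <= z) = (x <= z + y).
Proof. by rewrite -[LHS]bl_subr_ge0 opprB addrA bl_subr_ge0 addrC. Qed.

Lemma bl_addr_ge0 x y : 0 <= x -> 0 <= y -> 0 <= x + y.
Proof. by move=> x0 y0; rewrite -(addr0 0); exact: bl_lerD. Qed.

Lemma bl_sumr_ge0 (I : Type) (l : seq I) (P : pred I) (F : I -> E) :
  (forall i, P i -> 0 <= F i) -> 0 <= \sum_(i <- l | P i) F i.
Proof. by move=> F0; elim/big_ind: _ => //; exact: bl_addr_ge0. Qed.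

Lemma bl_lerZ r x y : 0 <= r -> x <= y -> r *: x <= r *: y.
Proof.
by move=> r0; rewrite -bl_subr_ge0 => xy; rewrite -bl_subr_ge0 -scalerBr;
  exact: banach_lattice_scale_ge0.
Qed.

Lemma bl_lerZl r s x : r <= s -> 0 <= x -> r *: x <= s *: x.
Proof.
move=> rs x0; rewrite -bl_subr_ge0 -scalerBl.
by apply: banach_lattice_scale_ge0 => //; rewrite subr_ge0.
Qed.

Lemma joinDr x y z : Order.join x y + z = Order.join (x + z) (y + z).
Proof.
apply/eqP; rewrite eq_le leUx !banach_lattice_leD2r ?leUl ?leUr//= andbT.
rewrite -[leRHS](subrK z); apply: banach_lattice_leD2r; rewrite leUx.
by rewrite -{1}[x](addrK z) -{2}[y](addrK z) !banach_lattice_leD2r ?leUl ?leUr.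
Qed.

Lemma oppr_join x y : - Order.join x y = Order.meet (- x) (- y).
Proof.
apply/eqP; rewrite eq_le lexI !bl_lerN2 leUl leUr/=.
by rewrite -[leLHS]opprK bl_lerN2 leUx -bl_lerN2 opprK leIl -bl_lerN2 opprK leIr.
Qed.

Lemma meetDr x y z : Order.meet x y + z = Order.meet (x + z) (y + z).
Proof.
rewrite -[x]opprK -[y]opprK -oppr_join -[z]opprK -opprD joinDr oppr_join.
by rewrite !opprD.
Qed.

Lemma pos_ge0 x : 0 <= pos x. Proof. exact: leUr. Qed.

Lemma pos_ge x : x <= pos x. Proof. exact: leUl. Qed.

Lemma pos_le x y : x <= y -> 0 <= y -> pos x <= y.
Proof. by move=> xy y0; rewrite /pos leUx xy. Qed.

Lemma pos_id x : 0 <= x -> pos x = x.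
Proof. by move=> x0; exact: join_l. Qed.

Lemma le_pos x y : x <= y -> pos x <= pos y.
Proof. by move=> xy; apply: pos_le (pos_ge0 _); exact: le_trans (pos_ge _). Qed.

Lemma posN x : pos (- x) = pos x - x.
Proof. by rewrite /pos joinDr subrr add0r joinC. Qed.

Lemma posB x : pos x - pos (- x) = x.
Proof. by rewrite posN opprB addrC subrK. Qed.

Lemma meet_pos x : Order.meet (pos x) (pos (- x)) = 0.
Proof.
have -> : pos x = x + pos (- x) by rewrite posN addrC subrK.
rewrite -{2}[pos (- x)]add0r -meetDr -{1}[x]opprK -{1}[0]oppr0 -oppr_join.
by rewrite -/(pos _) addNr.
Qed.

Lemma posZ r x : 0 <= r -> pos (r *: x) = r *: pos x.
Proof.
rewrite le0r => /orP[/eqP ->|r0]; first by rewrite !scale0r pos_id.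
apply/eqP; rewrite eq_le pos_le ?bl_lerZ ?pos_ge ?(ltW r0)//=; last first.
  by apply: banach_lattice_scale_ge0; rewrite ?pos_ge0// ltW.
rewrite -[X in _ <= X](scalerKV (lt0r_neq0 r0)) bl_lerZ ?(ltW r0)//.
have r'0 : 0 <= r^-1 by rewrite invr_ge0 ltW.
apply: pos_le; last by apply: banach_lattice_scale_ge0; rewrite ?pos_ge0.
by rewrite -{1}[x](scalerK (lt0r_neq0 r0)) bl_lerZ// pos_ge.
Qed.

Lemma posD x y : pos (x + y) <= pos x + pos y.
Proof.
by apply: pos_le; [exact: bl_lerD (pos_ge _) (pos_ge _)
                  |apply: bl_addr_ge0; exact: pos_ge0].
Qed.

Lemma modulusE x : modulus x = pos x + pos (- x).
Proof.
rewrite posN addrA -mulr2n -scaler_nat -posZ// scaler_nat mulr2n.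
by rewrite /pos joinDr addrK add0r.
Qed.

Lemma modulus_ge0 x : 0 <= modulus x.
Proof. by rewrite modulusE; apply: bl_addr_ge0; exact: pos_ge0. Qed.

Lemma modulus_ge x : x <= modulus x. Proof. exact: leUl. Qed.

Lemma modulus_geN x : - x <= modulus x. Proof. exact: leUr. Qed.

Lemma modulusN x : modulus (- x) = modulus x.
Proof. by rewrite /modulus opprK joinC. Qed.

Lemma modulus_le x y : x <= y -> - x <= y -> modulus x <= y.
Proof. by move=> xy nxy; rewrite /modulus leUx xy. Qed.

Lemma modulus_id x : 0 <= x -> modulus x = x.
Proof.
by move=> x0; apply: join_l; apply: le_trans (x0); rewrite -oppr0 bl_lerN2.
Qed.

Lemma modulusD x y : modulus (x + y) <= modulus x + modulus y.
Proof.
apply: modulus_le; first exact: bl_lerD (modulus_ge _) (modulus_ge _).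
by rewrite opprD; exact: bl_lerD (modulus_geN _) (modulus_geN _).
Qed.

Lemma modulus_pos_le x : modulus (pos x) <= modulus x.
Proof.
rewrite modulus_id ?pos_ge0//; apply: pos_le (modulus_ge0 _).
exact: modulus_ge.
Qed.

Lemma le_norm_bl x y : 0 <= x -> x <= y -> `|x| <= `|y| :> R.
Proof.
move=> x0 xy; apply: banach_lattice_le_norm.
by rewrite !modulus_id// (le_trans x0 xy).
Qed.

Lemma norm_modulus x : `|modulus x| = `|x| :> R.
Proof.
have mm : modulus (modulus x) = modulus x by rewrite modulus_id ?modulus_ge0.
by apply: le_anti; rewrite !banach_lattice_le_norm ?mm.
Qed.

Lemma norm_pos_le x : `|pos x| <= `|x| :> R.
Proof. by rewrite banach_lattice_le_norm ?modulus_pos_le. Qed.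

Lemma modulusB_le x y z : 0 <= x <= z -> 0 <= y <= z -> modulus (x - y) <= z.
Proof.
move=> /andP[x0 xz] /andP[y0 yz]; apply: modulus_le; rewrite ?opprB.
  exact: le_trans (bl_gerDl _ y0) xz.
exact: le_trans (bl_gerDl _ x0) yz.
Qed.

(** The witness is the meet of [x] and [a]; the remainder is then the positive part of [x - a],
    which is at most [b]. *)
Lemma riesz_decomposition x a b : 0 <= x -> 0 <= a -> 0 <= b -> x <= a + b ->
  exists2 y, 0 <= y <= a & 0 <= x - y <= b.
Proof.
move=> x0 a0 b0 xab; exists (Order.meet x a); first by rewrite lexI x0 a0 leIr.
rewrite bl_subr_ge0 leIl/= -[Order.meet x a]opprK opprK -[- _]opprK.
rewrite -[x]opprK -[a]opprK -oppr_join !opprK addrC joinDr addNr.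
by rewrite leUx b0/= addrC bl_lerBlDr addrC.
Qed.

Lemma riesz_decomposition_sum (I : finType) (a : I -> E) x :
  (forall i, 0 <= a i) -> 0 <= x -> x <= \sum_i a i ->
  exists2 y : I -> E, (forall i, 0 <= y i <= a i) & x = \sum_i y i.
Proof.
move=> a0; rewrite -big_enum; move: (enum_uniq I).
suff H (s : seq I) : uniq s -> forall x, 0 <= x -> x <= \sum_(i <- s) a i ->
    exists2 y : I -> E, (forall i, 0 <= y i <= a i) & x = \sum_(i <- s) y i.
  by move=> us x0 xa; have [y ya ->] := H _ us _ x0 xa; exists y => //; rewrite big_enum.
elim: s => [_ {}x x0 xa|i s IHs /= /andP[iNs us] {}x x0].
  exists (fun=> 0) => [i|]; first by rewrite lexx a0.
  by move: xa; rewrite !big_nil => xa; apply/eqP; rewrite eq_le xa x0.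
rewrite big_cons => xa.
have [y yai /andP[xy0 xys]] := riesz_decomposition x0 (a0 i)
  (bl_sumr_ge0 _ (fun i _ => a0 i)) xa.
have [z za xyz] := IHs us _ xy0 xys.
(* The enumeration is duplicate-free, so setting the value at [i] does not disturb the sum over the
   tail [s]. *)
exists (fun j => if j == i then y else z j) => [j|].
  by case: eqP => [->|].
rewrite big_cons eqxx -[x](subrK y) addrC xyz; congr (_ + _).
apply: eq_big_seq => j js; case: eqP => // ji.
by rewrite -ji js in iNs.
Qed.

Lemma meetD_le x y z : 0 <= x -> 0 <= y -> 0 <= z ->
  Order.meet x (y + z) <= Order.meet x y + Order.meet x z.
Proof.
move=> x0 y0 z0; set w := Order.meet _ _.
have w0 : 0 <= w by rewrite lexI x0 bl_addr_ge0.
have [t /andP[t0 ty] /andP[wt0 wtz]] :=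
  riesz_decomposition w0 y0 z0 (leIr _ _).
rewrite -[w](subrK t) addrC; apply: bl_lerD; rewrite lexI ?ty ?wtz andbT.
  by apply: le_trans (leIl x (y + z)); rewrite -bl_subr_ge0.
by apply: le_trans (leIl x (y + z)); exact: bl_gerDl.
Qed.

Lemma disjoint_le x y a b : 0 <= x <= a -> 0 <= y <= b ->
  Order.meet a b = 0 -> Order.meet x y = 0.
Proof.
move=> /andP[x0 xa] /andP[y0 yb] ab; apply: le_anti.
by rewrite -{1}ab leI2//= lexI x0.
Qed.

Lemma disjointD x y z : 0 <= x -> 0 <= y -> 0 <= z ->
  Order.meet x y = 0 -> Order.meet x z = 0 -> Order.meet x (y + z) = 0.
Proof.
move=> x0 y0 z0 xy xz; apply: le_anti; rewrite lexI x0 bl_addr_ge0// andbT.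
by rewrite (le_trans (meetD_le x0 y0 z0))// xy xz addr0.
Qed.

Lemma disjoint_sum_le x y z : Order.meet x y = 0 -> x <= z -> y <= z ->
  x + y <= z.
Proof.
move=> xy xz yz; suff -> : x + y = Order.join x y by rewrite leUx xz.
rewrite -[LHS]subr0 -xy -[x]opprK -[y]opprK -oppr_join !opprK addrC.
by rewrite joinDr addrA addNr add0r addrC addrK joinC.
Qed.

End RieszSpace.

(** * The Hahn-Banach theorem for sublinear functionals *)

Section HahnBanach.
Context {R : realType} {V : lmodType R}.
Implicit Types (P Q : V -> R) (x y z : V) (r t : R).

Definition sublinear P :=
  (forall x y, P (x + y) <= P x + P y) /\
  (forall r x, 0 <= r -> P (r *: x) = r * P x).

Lemma sublinear0 P : sublinear P -> P 0 = 0.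
Proof. by move=> [_ /(_ 0 0 (lexx _))]; rewrite scale0r mul0r. Qed.

Lemma sublinearN_le P x : sublinear P -> - P (- x) <= P x.
Proof.
move=> sP; rewrite -subr_ge0 opprK -(sublinear0 sP) -(subrr x).
exact: sP.1.
Qed.

(** Serves both the tilted functionals and the chains in Zorn's lemma. The minorant [l] keeps the
    infima finite and, with a member vanishing at 0, fixes the value at 0. *)
Lemma sublinear_inf (I : Type) (D : set I) (F : I -> V -> R) (l : V -> R) :
  D !=set0 -> (forall i x, D i -> l x <= F i x) -> l 0 = 0 ->
  (exists2 i, D i & F i 0 = 0) ->
  (forall i j x y, D i -> D j ->
    exists2 k, D k & F k (x + y) <= F i x + F j y) ->
  (forall i r x, D i -> 0 < r -> exists2 k, D k & F k (r *: x) <= r * F i x) ->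
  sublinear (fun x => inf [set F i x | i in D]) /\
  (forall i x, D i -> inf [set F i x | i in D] <= F i x).
Proof.
move=> [i0 Di0] lF l0 [i1 Di1 Fi1] FD FZ.
have le_inf_F i x : D i -> inf [set F i x | i in D] <= F i x.
  move=> Di; apply: ge_inf; last by exists i.
  by exists (l x) => _ [j Dj <-]; exact: lF.
have ge_inf_F m x : (forall i, D i -> m <= F i x) -> m <= inf [set F i x | i in D].
  move=> mF; apply: lb_le_inf; first by exists (F i0 x); exists i0.
  by move=> _ [j Dj <-]; exact: mF.
set q := fun x => inf [set F i x | i in D].
have qZ_le r x : 0 < r -> q (r *: x) <= r * q x.
  move=> r0; rewrite -ler_pdivrMl//; apply: ge_inf_F => i Di.
  rewrite ler_pdivrMl//; have [k Dk] := FZ i r x Di r0.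
  by apply: le_trans; exact: le_inf_F.
split; last exact: le_inf_F.
split => [x y|r x]; last first.
  rewrite le0r => /orP[/eqP ->|r0].
    rewrite scale0r mul0r; apply/eqP; rewrite eq_le; apply/andP; split.
      by rewrite -Fi1; exact: le_inf_F.
    by apply: ge_inf_F => i Di; rewrite -l0; exact: lF.
  apply/eqP; rewrite eq_le qZ_le//= -ler_pdivlMl//.
  by rewrite -{1}[x](scalerK (lt0r_neq0 r0)) qZ_le ?invr_gt0.
rewrite -lerBlDr; apply: (ge_inf_F) => i Di.
rewrite lerBlDr [leRHS]addrC -lerBlDr; apply: (ge_inf_F) => j Dj.
rewrite lerBlDr [leRHS]addrC; have [k Dk] := FD i j x y Di Dj.
by apply: le_trans; exact: le_inf_F.
Qed.

(** [Q] is the infimum over t >= 0 of [P (x + t *: z) - t * P z]; t = 0 and t = 1 give the two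
    bounds. At [- z] the second one reads [Q (- z) <= - P z], so a linear functional below [Q] is at
    least [P z] at [z]. *)
Lemma sublinear_tilt P z : sublinear P ->
  exists Q, [/\ sublinear Q, forall x, Q x <= P x &
    forall x, Q x <= P (x + z) - P z].
Proof.
move=> sP.
have [||||||sQ Qle] := @sublinear_inf R [set t | 0 <= t]
    (fun t x => P (x + t *: z) - t * P z) (fun x => - P (- x)).
- by exists 0 => /=.
- move=> t x /= t0; rewrite lerBrDl -sP.2// lerBlDr.
  by rewrite -{1}[t *: z](addKr x) addrC [x + _]addrC; apply: sP.1.
- by rewrite oppr0 sublinear0// oppr0.
- by exists 0; rewrite /= ?scale0r ?mul0r ?addr0 ?subr0 ?sublinear0.
- move=> s t x y /= s0 t0; exists (s + t); first exact: addr_ge0.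
  by rewrite scalerDl addrACA mulrDl opprD [leRHS]addrACA lerD2r; exact: sP.1.
- move=> t r x /= t0 r0; exists (r * t); first by rewrite mulr_ge0// ltW.
  by rewrite -scalerA -scalerDr sP.2 ?(ltW r0)// -mulrA -mulrBr.
exists (fun x => inf [set P (x + t *: z) - t * P z | t in [set t | 0 <= t]]).
split=> // x.
  by apply: le_trans (Qle 0 x _) _ => //=; rewrite scale0r mul0r addr0 subr0.
by apply: le_trans (Qle 1 x _) _ => //=; rewrite scale1r mul1r.
Qed.

(** Zorn's lemma for the reversed pointwise order. Sublinear functionals below [P] stay above
    [- P (- x)], so a nonempty chain has a pointwise infimum, sublinear because any two members are
    comparable. *)
Lemma sublinear_minimal P : sublinear P ->
  exists Q, [/\ sublinear Q, forall x, Q x <= P x &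
    forall Q', sublinear Q' -> (forall x, Q' x <= Q x) ->
      forall x, Q x <= Q' x].
Proof.
move=> sP; pose T := {Q : V -> R | sublinear Q /\ forall x, Q x <= P x}.
pose ge (Q1 Q2 : T) : bool := `[< forall x, sval Q2 x <= sval Q1 x >].
have lP (Q : T) x : - P (- x) <= sval Q x.
  by case: Q => Q [sQ QP] /=; rewrite (le_trans _ (sublinearN_le x sQ))// lerN2.
have [||A totA|[Q [sQ QP]] Qmin] := @ZL_preorder T
  (exist _ P (conj sP (fun x => lexx (P x)))) ge.
- by move=> Q; apply/asboolP.
- move=> Q1 Q2 Q3 /asboolP h1 /asboolP h2; apply/asboolP => x.
  exact: le_trans (h2 x) (h1 x).
- have [[Q0 AQ0]|A0] := pselect (A !=set0); last first.
    exists (exist _ P (conj sP (fun x => lexx (P x)))) => Q AQ.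
    by exfalso; apply: A0; exists Q.
  have [||||||sQ Qle] := @sublinear_inf T A (fun K x => sval K x) (fun x => - P (- x)).
  + by exists Q0.
  + by move=> Q x _; exact: lP.
  + by rewrite oppr0 sublinear0// oppr0.
  + by exists Q0 => //; exact: sublinear0 (svalP Q0).1.
  + move=> Q1 Q2 x y AQ1 AQ2.
    have [/asboolP h|/asboolP h] := totA _ _ AQ1 AQ2.
      exists Q2 => //; apply: le_trans ((svalP Q2).1.1 x y) _.
      by rewrite lerD2r; exact: h.
    exists Q1 => //; apply: le_trans ((svalP Q1).1.1 x y) _.
    by rewrite lerD2l; exact: h.
  + by move=> Q r x AQ r0; exists Q => //; rewrite (svalP Q).1.2// ltW.
  have QP x : inf [set sval Q x | Q in A] <= P x.
    by apply: le_trans (Qle Q0 x AQ0) _; exact: (svalP Q0).2.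
  exists (exist (fun q => sublinear q /\ forall x, q x <= P x)
    (fun x => inf [set sval Q x | Q in A]) (conj sQ QP)) => Q AQ; apply/asboolP => x /=.
  exact: Qle.
exists Q; split=> // Q' sQ' Q'Q x.
have Q'P y : Q' y <= P y by exact: le_trans (Q'Q y) (QP y).
have /Qmin/asboolP : ge (exist _ Q (conj sQ QP)) (exist _ Q' (conj sQ' Q'P)).
  exact/asboolP.
exact.
Qed.

(** A minimal sublinear functional is linear: its tilt along [y] cannot be smaller, so
    [Q x <= Q (x + y) - Q y], the reverse of subadditivity. Tilting [P] along [z] beforehand secures
    the value at [z]. *)
Lemma hahn_banach_sublinear P z : sublinear P ->
  exists f : {scalar V}, (forall x, f x <= P x) /\ f z = P z.
Proof.
move=> sP; have [P' [sP' P'P P'z]] := sublinear_tilt z sP.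
have [Q [sQ QP' Qmin]] := sublinear_minimal sP'.
have QD x y : Q (x + y) = Q x + Q y.
  apply/eqP; rewrite eq_le sQ.1/= -lerBrDr.
  have [Q' [sQ' Q'Q Q'y]] := sublinear_tilt y sQ.
  by apply: le_trans (Q'y x); exact: Qmin.
have QN x : Q (- x) = - Q x.
  by apply/eqP; rewrite -subr_eq0 opprK -QD addNr sublinear0.
have QZ r x : Q (r *: x) = r * Q x.
  have [r0|r0] := leP 0 r; first exact: sQ.2.
  rewrite -[r]opprK scaleNr QN sQ.2 ?oppr_ge0 ?(ltW r0)//.
  by rewrite !mulNr.
have Qlin : scalar Q by move=> r x y; rewrite QD QZ.
pose f : {scalar V} := HB.pack Q (GRing.isLinear.Build R V R *%R Q Qlin).
exists f; split=> [x|]; first exact: le_trans (QP' x) (P'P x).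
apply/eqP; rewrite eq_le; apply/andP; split.
  exact: le_trans (QP' z) (P'P z).
rewrite -lerN2 -[- f z]QN; apply: le_trans (QP' _) _.
by apply: le_trans (P'z _) _; rewrite addNr sublinear0// sub0r.
Qed.

End HahnBanach.

(** * Total boundedness *)

Section Colouring.
Context {R : realType}.

(* Total boundedness for a distance [d] that need not be a metric, phrased
   with finite colourings so that finite products of colourings can be used. *)
Definition totally_bounded (Y : Type) (A : set Y) (d : Y -> Y -> R) :=
  forall e, 0 < e -> exists (I : finType) (c : Y -> I),
    forall x y, A x -> A y -> c x = c y -> d x y < e.

Lemma totally_bounded_subset (Y : Type) (A B : set Y) (d : Y -> Y -> R) :
  A `<=` B -> totally_bounded B d -> totally_bounded A d.
Proof.
move=> AB tB e /tB[I [c cP]]; exists I, c => x y Ax Ay.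
by apply: cP; exact: AB.
Qed.

Lemma precompact_totally_bounded (Y : Type) (X : normedModType R) (f : Y -> X)
    (A : set Y) :
  precompact (f @` A) -> totally_bounded A (fun x y => `|f x - f y|).
Proof.
rewrite precompactE compact_cover => fA e e0.
have e20 : 0 < e / 2 by rewrite divr_gt0.
have [||D' _ fAD] := fA X setT (fun z => ball z (e / 2)).
- by move=> z _; exact: ball_open.
- by move=> z _; exists z => //; exact: ballxx.
exists (option D'), (fun x => [pick i : D' | `|val i - f x| < e / 2]) => x y Ax Ay.
have fP x' : A x' -> exists i : D', `|val i - f x'| < e / 2.
  move=> Ax'; have [|z zD zx] := fAD (f x').
    by apply: subset_closure; exists x'.
  by exists [` zD]%fset; move: zx; rewrite -ball_normE.
case: pickP => [i ix|noi]; last first.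
  by have [i] := fP _ Ax; rewrite noi.
case: pickP => [j jy [ij]|noi]; last by [].
rewrite -{}ij in jy.
rewrite -(subrK (val i) (f x)) -addrA (splitr e).
by apply: le_lt_trans (ler_normD _ _) _; rewrite ltrD// distrC.
Qed.

(** An ultrafilter containing the closure is Cauchy: otherwise, for some [e], it contains the
    complements of the [e]-balls around one representative per colour, and these finitely many sets
    have no common point in the closure. Completeness supplies the limit. *)
Lemma totally_bounded_precompact (Y : Type) (X : completeNormedModType R)
    (f : Y -> X) (A : set Y) :
  totally_bounded A (fun x y => `|f x - f y|) -> precompact (f @` A).
Proof.
move=> tbA; rewrite precompactE compact_ultra => F UF FA.
have : cauchy_ex F.
  move=> e e0; have [I [c cP]] := tbA _ (divr_gt0 e0 (ltr0n R 2)).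
  (* The image of a representative of colour [i]; the default 0 serves colours absent from [A]. *)
  pose g i : X := xget 0 [set f a | a in A `&` c @^-1` [set i]].
  have [//|noF] := pselect (exists x, F (ball x e)).
  have FN : F (fun z => forall i, ~ ball (g i) e z).
    apply: filter_forall => i.
    have [Fi|//] := in_ultra_setVsetC (ball (g i) e) UF.
    by exfalso; apply: noF; exists (g i).
  have [z [zA zN]] := filter_ex (filterI FA FN).
  have [_ [[a Aa <-]]] := zA _ (nbhsx_ballx z (e / 2) (divr_gt0 e0 (ltr0n R 2))).
  rewrite -ball_normE /= => za; exfalso; apply: (zN (c a)).
  have /(xgetPex 0)[b [Ab cb]] :
      exists x, [set f a' | a' in A `&` c @^-1` [set c a]] x.
    by exists (f a), a.
  rewrite -/(g _) -ball_normE /= => <-.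
  rewrite -(subrK (f a) (f b)) -addrA (splitr e).
  apply: le_lt_trans (ler_normD _ _) _.
  by rewrite ltrD ?cP// distrC.
move=> /cauchy_exP/cauchy_cvg cvF; exists (lim F); split => //.
exact: (closed_cvg (closure (f @` A)) (@closed_closure _ _) FA).
Qed.

Lemma bounded_setP (X : normedModType R) (A : set X) : bounded_set A <->
  exists M : R, forall x, A x -> `|x| <= M.
Proof.
split=> [/pinfty_ex_gt0[M _ AM]|[M AM]]; first by exists M.
by exists M; split; [exact: num_real|move=> N MN x /AM xM; exact: le_trans (ltW MN)].
Qed.

End Colouring.

(** * Positive functionals and operators *)

Section PositiveMaps.
Context {R : realType}.

Definition positive_functional {E : banachLatticeType R} (f : {scalar E}) :=
  forall x, 0 <= x -> 0 <= f x.

Lemma positive_functional_le (E : banachLatticeType R) (f : {scalar E}) x y :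
  positive_functional f -> x <= y -> f x <= f y.
Proof. by move=> f0; rewrite -bl_subr_ge0 -subr_ge0 -raddfB => /f0. Qed.

Lemma positive_operator_le (E F : banachLatticeType R) (T : {linear E -> F})
    x y : positive_operator T -> x <= y -> T x <= T y.
Proof.
move=> T0 xy; rewrite -bl_subr_ge0 -raddfB; apply: T0.
by rewrite bl_subr_ge0.
Qed.

Lemma positive_operator_modulus (E F : banachLatticeType R)
    (T : {linear E -> F}) x : positive_operator T ->
  modulus (T x) <= T (modulus x).
Proof.
move=> T0; apply: modulus_le; rewrite -?raddfN; apply: positive_operator_le => //.
  exact: modulus_ge.
exact: modulus_geN.
Qed.

Lemma positive_operator_norm (E F : banachLatticeType R)
    (S T : {linear E -> F}) x : positive_operator S -> operator_le S T ->
  `|S x| <= `|T (modulus x)|.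
Proof.
move=> S0 ST; rewrite -norm_modulus; apply: le_norm_bl (modulus_ge0 _) _.
apply: le_trans (positive_operator_modulus x S0) _.
exact/ST/modulus_ge0.
Qed.

(** Hahn-Banach below the norm of the positive part: this bound vanishes at [- x] for [0 <= x],
    which makes [f] positive, and it never exceeds the norm. *)
Lemma norming_functional (E : banachLatticeType R) (z : E) : 0 <= z ->
  exists f : {scalar E},
    [/\ positive_functional f, forall x, `|f x| <= `|x| & f z = `|z|].
Proof.
move=> z0; have sP : sublinear (fun x : E => `|pos x|).
  split=> [x y|r x r0]; last by rewrite posZ// normrZ ger0_norm.
  by apply: le_trans (ler_normD _ _); rewrite le_norm_bl ?pos_ge0 ?posD.
have [f [fP fz]] := hahn_banach_sublinear z sP.
exists f; split=> [x x0|x|]; last by rewrite fz pos_id.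
- rewrite -oppr_le0 -raddfN; apply: le_trans (fP _) _.
  by rewrite posN pos_id// subrr normr0.
- rewrite ler_norml; apply/andP; split; last first.
    exact: le_trans (fP _) (norm_pos_le _).
  rewrite lerNl -raddfN -(normrN x).
  exact: le_trans (fP _) (norm_pos_le _).
Qed.

(** Hahn-Banach below [g (pos x)]: the supremum of [f z] over all functionals between 0 and [g] is
    attained. *)
Lemma dominated_functional (E : banachLatticeType R) (g : {scalar E}) (z : E) :
  positive_functional g -> exists f : {scalar E},
    (forall x, 0 <= x -> 0 <= f x <= g x) /\ f z = g (pos z).
Proof.
move=> g0; have sP : sublinear (fun x : E => g (pos x)).
  split=> [x y|r x r0]; last by rewrite posZ// linearZ.
  by rewrite -raddfD; apply: positive_functional_le g0 (posD _ _).
have [f [fP fz]] := hahn_banach_sublinear z sP.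
exists f; split=> // x x0; rewrite -{3}[x]pos_id// fP andbT.
rewrite -oppr_le0 -raddfN; apply: le_trans (fP _) _.
by rewrite posN pos_id// subrr raddf0.
Qed.

(** [f] is the sum of norming functionals at one representative [g a] per colour. The functional of
    the colour of [x] recovers the norm of [g x] up to [e], and by positivity of the other summands
    [f] dominates it at [g x]. *)
Lemma positive_functional_controls (Y : Type) (E : banachLatticeType R)
    (D : set Y) (g : Y -> E) (e : R) :
  0 < e -> (forall x, D x -> 0 <= g x) ->
  totally_bounded D (fun x y => `|g x - g y|) ->
  exists f : {scalar E}, [/\ positive_functional f,
    exists M, forall x, `|f x| <= M * `|x| &
    forall x, D x -> f (g x) < e -> `|g x| < e *+ 2].
Proof.
move=> e0 g0 tbD; have e20 : 0 < e / 2 by rewrite divr_gt0.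
have [I [c cP]] := tbD _ e20.
have /choice[h hP] (i : I) : exists f : {scalar E}, [/\ positive_functional f,
    forall x, `|f x| <= `|x| & forall x, D x -> c x = i -> `|g x| < f (g x) + e].
  have [[a [Da ca]]|noa] := pselect (exists a, D a /\ c a = i); last first.
    exists (\0)%R; split=> [x _ //|x|x Dx cx]; first by rewrite normr0.
    by exfalso; apply: noa; exists x.
  have [f [f0 f1 fa]] := norming_functional (g0 _ Da).
  exists f; split=> // x Dx cx.
  have gxa : `|g x - g a| < e / 2 by apply: cP => //; rewrite cx.
  have fxa := le_lt_trans (f1 _) gxa.
  have := ler_normD (g x - g a) (g a); rewrite subrK -fa => gx.
  by move: fxa; rewrite raddfB ltr_norml => /andP[fxa _]; lra.
have hlin : scalar (fun x => \sum_i h i x).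
  move=> r x y; rewrite mulr_sumr -big_split; apply: eq_bigr => i _ /=.
  by rewrite linearP.
pose f : {scalar E} :=
  HB.pack (fun x => \sum_i h i x) (GRing.isLinear.Build R E R *%R _ hlin).
exists f; split.
- by move=> x x0; apply: sumr_ge0 => i _; have [+ _ _] := hP i; exact.
- exists #|I|%:R => x; apply: le_trans (ler_norm_sum _ _ _) _.
  rewrite mulr_natl -sumr_const; apply: ler_sum => i _.
  by have [_ + _] := hP i.
- move=> x Dx fx; have [_ _ /(_ x Dx erefl) gx] := hP (c x).
  apply: lt_le_trans gx _; rewrite mulr2n lerD2r; apply: le_trans (ltW fx).
  rewrite /f /= (bigD1 (c x)) //= lerDl; apply: sumr_ge0 => i _.
  by have [+ _ _] := hP i; apply; exact: g0.
Qed.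

End PositiveMaps.

(** * Disjointly weakly compact sets *)

Section DisjointlyWeaklyCompact.
Context {R : realType}.

Lemma bounded_operatorP (V W : normedModType R) (f : {linear V -> W}) :
  bounded_operator f <-> continuous f.
Proof.
rewrite -linear_bounded_continuous linear_boundedP; split=> [[M fM]|].
  exists M; split; first exact: num_real.
  by move=> N MN x; rewrite (le_trans (fM x))// ler_wpM2r// ltW.
by move=> /pinfty_ex_gt0[M _ fM]; exists M.
Qed.

Lemma Sol_idem (E : banachLatticeType R) (A : set E) : Sol (Sol A) `<=` Sol A.
Proof.
by move=> z [y [x Ax yx] zy]; exists x => //; exact: le_trans zy yx.
Qed.

Lemma disjointly_weakly_compact_Sol (E : banachLatticeType R) (A : set E) :
  disjointly_weakly_compact A -> disjointly_weakly_compact (Sol A).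
Proof.
move=> [/bounded_setP[M AM] Aw]; split.
  apply/bounded_setP; exists M => y [x /AM xM yx].
  exact: le_trans (banach_lattice_le_norm yx) xM.
by move=> y yA; apply: Aw => n; exact: Sol_idem.
Qed.

Lemma disjoint_seq_sum_le (E : banachLatticeType R) (y : nat -> E) (w : E) n :
  disjoint_seq y -> 0 <= w -> (forall k, modulus (y k) <= w) ->
  \sum_(i < n) modulus (y i) <= w.
Proof.
(* The induction also carries the disjointness of the partial sum from all later terms, so that
   adding the next term amounts to taking a join. *)
move=> dy w0 yw; suff [//] : \sum_(i < n) modulus (y i) <= w /\
    forall k, (n <= k)%N -> Order.meet (modulus (y k)) (\sum_(i < n) modulus (y i)) = 0.
elim: n => [|n [IH1 IH2]].
  rewrite big_ord0; split=> // k _; apply/eqP.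
  by rewrite eq_le leIr lexI modulus_ge0 lexx.
rewrite big_ord_recr /=; split=> [|k nk].
  by apply: disjoint_sum_le => //; rewrite meetC IH2.
apply: disjointD; rewrite ?modulus_ge0//.
- by apply: bl_sumr_ge0 => i _; exact: modulus_ge0.
- by apply: IH2; exact: ltnW.
- by apply: dy => kn; rewrite kn ltnn in nk.
Qed.

Lemma modulus_sum_le (E : banachLatticeType R) (I : Type) (l : seq I)
    (y : I -> E) :
  modulus (\sum_(i <- l) y i) <= \sum_(i <- l) modulus (y i).
Proof.
elim: l => [|i l IH]; first by rewrite !big_nil modulus_id.
by rewrite !big_cons; apply: le_trans (modulusD _ _) (bl_lerD _ IH).
Qed.

(* Choosing signs turns the sum of the |f (y i)| into the value of f at one
   vector of modulus at most w, so the series of the |f (y i)| converges. *)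
Lemma disjoint_order_bounded_weak_cvg (E : banachLatticeType R) (w : E)
    (y : nat -> E) :
  0 <= w -> (forall n, modulus (y n) <= w) -> disjoint_seq y -> weak_cvg y 0.
Proof.
move=> w0 yw dy f /bounded_operatorP[M fM]; rewrite raddf0.
have M'0 : 0 <= Num.max M 0 by rewrite le_max lexx orbT.
have {}fM x : `|f x| <= Num.max M 0 * `|x|.
  by rewrite (le_trans (fM x))// ler_wpM2r// le_max lexx.
apply/norm_cvg0P; apply: cvg_series_cvg_0.
apply: nondecreasing_is_cvgn.
  move=> n m nm; rewrite -subr_ge0 sub_series_geq//.
  by apply: sumr_ge0 => i _.
exists (Num.max M 0 * `|w|) => _ [n _ <-].
rewrite /series /= big_mkord.
pose s : E := \sum_(i < n) (if 0 <= (f (y i) : R) then y i else - y i).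
have -> : \sum_(i < n) `|f (y i)| = f s.
  rewrite raddf_sum; apply: eq_bigr => i _.
  by case: ifPn => [/ger0_norm //|]; rewrite -ltNge raddfN => /ltr0_norm.
apply: le_trans (ler_norm _) _; apply: le_trans (fM _) _.
apply: ler_wpM2l => //; apply: banach_lattice_le_norm.
rewrite [leRHS]modulus_id//; apply: le_trans (modulus_sum_le _ _) _.
apply: le_trans (disjoint_seq_sum_le n dy w0 yw).
rewrite (eq_bigr (fun i : 'I_n => modulus (y i)))// => i _.
by case: ifP => // _; rewrite modulusN.
Qed.

Lemma disjointly_weakly_compact_interval (E : banachLatticeType R) (w : E) :
  0 <= w -> disjointly_weakly_compact [set x : E | 0 <= x <= w].
Proof.
move=> w0; split.
  by apply/bounded_setP; exists `|w| => x /andP[x0 xw]; exact: le_norm_bl.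
move=> y yS; apply: disjoint_order_bounded_weak_cvg w0 _ => n.
have [x /= /andP[x0 xw] yx] := yS n.
by apply: le_trans yx _; rewrite modulus_id.
Qed.

Lemma DW_compact_totally_bounded (E : banachLatticeType R)
    (X : completeNormedModType R) (T : {linear E -> X}) (A : set E) :
  DW_compact T -> disjointly_weakly_compact A ->
  totally_bounded A (fun x y => `|T x - T y|).
Proof. by move=> [_ TA] /TA; exact: precompact_totally_bounded. Qed.

(** [T] has totally bounded image on the positive part of [Sol A], so one positive functional [f]
    controls the norm there. The composite of [f] and [T] is continuous, and [v] is weakly null. *)
Lemma DW_compact_disjoint_cvg (E F : banachLatticeType R) (T : {linear E -> F})
    (A : set E) (v : nat -> E) (e : R) :
  positive_operator T -> DW_compact T -> disjointly_weakly_compact A ->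
  (forall n, Sol A (v n)) -> (forall n, 0 <= v n) -> disjoint_seq v ->
  0 < e -> \forall n \near \oo, `|T (v n)| < e.
Proof.
move=> T0 DT dA vA v0 dv e0.
have e20 : 0 < e / 2 by rewrite divr_gt0.
have tbA := totally_bounded_subset (@subIsetl _ (Sol A) [set x | 0 <= x])
  (DW_compact_totally_bounded DT (disjointly_weakly_compact_Sol dA)).
have [|f [f0 [M fM] fP]] := positive_functional_controls e20 _ tbA.
  by move=> x [_ /T0].
have hlin : linear ((fun x => f (T x)) : E -> R^o).
  by move=> r x y; rewrite !linearP.
pose h : {linear E -> R^o} :=
  HB.pack ((fun x => f (T x)) : E -> R^o) (GRing.isLinear.Build R E R^o *:%R _ hlin).
have hc : continuous h.
  apply/bounded_operatorP; have [[N TN] _] := DT.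
  exists (`|M| * N) => x; apply: le_trans (fM _) _.
  rewrite -mulrA (le_trans (ler_wpM2r _ (ler_norm M)))//.
  by rewrite ler_wpM2l.
have := dA.2 v vA dv h hc; rewrite raddf0 => /cvgr0_norm_lt/(_ _ e20).
apply: filterS => n /= fn.
rewrite [ltRHS](_ : e = (e / 2) *+ 2); last by rewrite mulr2n -splitr.
apply: fP; first by split; [exact: vA|exact: v0].
exact: le_lt_trans (ler_norm _) fn.
Qed.

End DisjointlyWeaklyCompact.

(** * Approximation by order intervals *)

Section AlmostOrderBounded.
Context {R : realType}.

(** The positive cone is closed: once [z <= u n], the norm of [pos (z - l)] is at most that of
    [u n - l]. *)
Lemma bl_ler_lim (E : banachLatticeType R) (u : nat -> E) (l z : E) :
  u n @[n --> \oo] --> l -> (\forall n \near \oo, z <= u n) -> z <= l.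
Proof.
move=> ul zu; have pos0 : pos (z - l) = 0.
  apply/eqP; rewrite -normr_eq0 -normr_le0 normr_id; apply/ler_addgt0Pr => e e0.
  rewrite add0r; have [n [zun lun]] := filter_ex (filterI zu (cvgr_dist_lt _ _ ul _ e0)).
  apply: ltW; apply: le_lt_trans lun; rewrite distrC.
  apply: le_trans (norm_pos_le _); apply: le_norm_bl (pos_ge0 _) _.
  by apply/le_pos/banach_lattice_leD2r.
by have := pos_ge (z - l); rewrite pos0 bl_lerBlDr add0r.
Qed.

(** Comparison with a geometric series makes the weighted series converge; each term lies below all
    later partial sums, hence below the limit. *)
Lemma summable_majorant (E : banachLatticeType R) (x : nat -> E) (M : R) :
  (forall n, 0 <= x n) -> (forall n, `|x n| <= M) ->
  exists y, forall n, 2^-1 ^+ n *: x n <= y.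
Proof.
move=> x0 xM; pose a n : E := 2^-1 ^+ n *: x n.
have a0 n : 0 <= a n by apply: banach_lattice_scale_ge0; rewrite // exprn_ge0.
have half : `|2^-1 : R| < 1 by rewrite ger0_norm// invf_lt1// ltr1n.
have ca : cvgn (series a).
  apply: normed_cvg; apply: (@series_le_cvg _ _ (geometric M 2^-1)) => [n|n|n|].
  - exact: normr_ge0.
  - rewrite /geometric /= mulr_ge0 ?exprn_ge0//.
    exact: le_trans (normr_ge0 _) (xM n).
  - rewrite /geometric /= normrZ ger0_norm ?exprn_ge0// mulrC.
    by rewrite ler_wpM2r ?exprn_ge0.
  - exact: is_cvg_geometric_series half.
exists (limn (series a)) => n; apply: bl_ler_lim ca _.
exists n.+1 => // m /= nm; rewrite /series /= big_mkord.
rewrite (bigD1 (Ordinal nm))//=; apply: bl_lerDl.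
by apply: bl_sumr_ge0 => i _; exact: a0.
Qed.

(* The sequence is built greedily: if no u works, pick x n violating the bound
   for u = 4^n * (x 0 + ... + x (n-1)).  With y majorizing all the 2^-n * x n,
   the vectors (x n - 4^n * (x 0 + ... + x (n-1)) - 2^-n * y)^+ are disjoint. *)
Lemma DW_compact_almost_order_bounded (E F : banachLatticeType R)
    (T : {linear E -> F}) (A : set E) (e : R) :
  positive_operator T -> DW_compact T -> disjointly_weakly_compact A ->
  0 < e -> exists2 u, 0 <= u &
    forall x, Sol A x -> 0 <= x -> `|T (pos (x - u))| < e.
Proof.
move=> T0 DT dA e0; apply: contrapT => noU.
have /choice[X XP] (u : E) : exists x, 0 <= u ->
    [/\ Sol A x, 0 <= x & e <= `|T (pos (x - u))|].
  have [u0|nu0] := pselect (0 <= u); last by exists 0.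
  apply: contrapT => nox; apply: noU; exists u => // x xA x0.
  by rewrite ltNge; apply/negP => ex; apply: nox; exists x.
pose s := fix s n : E := if n is k.+1 then s k + X (4 ^+ k *: s k) else 0.
pose x n := X (4 ^+ n *: s n).
have s4_ge0 n : 0 <= s n -> 0 <= 4 ^+ n *: s n.
  by apply: banach_lattice_scale_ge0; rewrite exprn_ge0.
have s0 n : 0 <= s n.
  elim: n => [|n IH] //=; apply: bl_addr_ge0 => //.
  by have [] := XP _ (s4_ge0 _ IH).
have xA n : Sol A (x n) by have [] := XP _ (s4_ge0 n (s0 n)).
have x0 n : 0 <= x n by have [] := XP _ (s4_ge0 n (s0 n)).
have ex n : e <= `|T (pos (x n - 4 ^+ n *: s n))|.
  by have [] := XP _ (s4_ge0 n (s0 n)).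
have sS n m : (n < m)%N -> x n <= s m.
  elim: m => // m IH; rewrite ltnS leq_eqVlt => /orP[/eqP <-|nm].
    by rewrite /= addrC; exact: bl_lerDl.
  by apply: le_trans (IH nm) _; exact: (bl_lerDl _ (x0 m)).
have /bounded_setP[M AM] := (disjointly_weakly_compact_Sol dA).1.
have [y yP] := summable_majorant x0 (fun n => AM _ (xA n)).
have h0 n : 0 <= 2^-1 ^+ n :> R by rewrite exprn_ge0.
have hy0 n : 0 <= 2^-1 ^+ n *: y.
  apply: banach_lattice_scale_ge0 => //.
  apply: le_trans (yP 0%N); exact: banach_lattice_scale_ge0.
pose v n := pos (x n - 4 ^+ n *: s n - 2^-1 ^+ n *: y).
have v0 n : 0 <= v n by exact: pos_ge0.
have vx n : v n <= x n.
  apply: pos_le => //; apply: le_trans (bl_gerDl _ (hy0 n)) _.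
  exact: bl_gerDl (s4_ge0 n (s0 n)).
have vA n : Sol A (v n).
  apply: Sol_idem; exists (x n) => //.
  by rewrite !modulus_id.
have vdisj n m : (n < m)%N -> Order.meet (v n) (v m) = 0.
  (* [v n] lies below the negative part of [z] and [v m] below its positive part. *)
  move=> nm; pose z : E := x m - 4 ^+ m *: x n.
  apply: (@disjoint_le _ _ _ _ (pos (- z)) (pos z)).
  - rewrite v0 /=; apply: pos_le (pos_ge0 _).
    (* [c] is the inverse of [4 ^+ m], so [c *: - z] is [x n - c *: x m], and [c *: x m <= 2^-1 ^+ m
       *: y <= 2^-1 ^+ n *: y]. *)
    pose c : R := 2^-1 ^+ m * 2^-1 ^+ m.
    have c0 : 0 <= c by rewrite mulr_ge0.
    apply: (@le_trans _ _ (c *: - z)); last first.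
      apply: le_trans (bl_lerZ c0 (pos_ge _)) _.
      rewrite -[leRHS]scale1r; apply: bl_lerZl (pos_ge0 _).
      by rewrite mulr_ile1// exprn_ile1// invf_le1// ler1n.
    rewrite opprB scalerBr scalerA.
    have -> : c * 4 ^+ m = 1.
      rewrite /c -!exprMn -invfM -natrM mulVf ?expr1n//.
    rewrite scale1r; apply: (@le_trans _ _ (x n - 2^-1 ^+ n *: y)).
      by apply: banach_lattice_leD2r; exact: bl_gerDl (s4_ge0 n (s0 n)).
    apply: bl_lerD => //; rewrite bl_lerN2.
    apply: le_trans (bl_lerZ (h0 n) (yP m)); rewrite !scalerA.
    apply: bl_lerZl => //; apply: ler_wpM2r => //.
    by rewrite ler_wiXn2l// ?invf_le1 ?ler1n// ltnW.
  - rewrite v0 /=; apply: le_pos; apply: le_trans (bl_gerDl _ (hy0 m)) _.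
    apply: bl_lerD => //; rewrite bl_lerN2; apply: bl_lerZ (sS _ _ nm).
    by rewrite exprn_ge0.
  - by rewrite meetC meet_pos.
have dv : disjoint_seq v.
  move=> n m; rewrite !modulus_id//.
  case: (ltngtP n m) => // [nm _|mn _]; first exact: vdisj.
  by rewrite meetC vdisj.
have e20 : 0 < e / 2 by rewrite divr_gt0.
have half : `|2^-1 : R| < 1 by rewrite ger0_norm// invf_lt1// ltr1n.
(* At such an [n], [pos (x n - 4 ^+ n *: s n) <= v n + 2^-1 ^+ n *: y] contradicts the greedy choice
   of [x n]. *)
have [n [vn yn]] := filter_ex (filterI
  (DW_compact_disjoint_cvg T0 DT dA vA v0 dv e20)
  (cvgr0_norm_lt _ (cvg_geometric `|T y| half) _ e20)).
have := ex n; rewrite leNgt => /negP; apply.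
apply: le_lt_trans (_ : _ <= `|T (v n)| + `|T (2^-1 ^+ n *: y)|) _.
  apply: le_trans (ler_normD _ _); apply: le_norm_bl (T0 _ (pos_ge0 _)) _.
  rewrite -raddfD; apply: positive_operator_le => //.
  rewrite -[2^-1 ^+ n *: y](pos_id (hy0 n)).
  by apply: le_trans (posD _ _); rewrite subrK.
rewrite (splitr e) ltrD// linearZ normrZ (ger0_norm (h0 n)) mulrC.
exact: le_lt_trans (ler_norm _) yn.
Qed.

End AlmostOrderBounded.

(** * Energy of a partition *)

Section Energy.
Context {R : realType}.
Implicit Types s t h : R.

(** Completing the square presents [s ^+ 2 / t] as a maximum over [h] of expressions linear in [s]
    and [t]; hence refinement cannot lower the energy. If [t = 0], then [s = 0] and the convention
    [0^-1 = 0] makes both sides vanish. *)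
Lemma energyE s t h : 0 <= s <= t ->
  s ^+ 2 / t = h *+ 2 * s - h ^+ 2 * t + (s - h * t) ^+ 2 / t.
Proof.
move=> /andP[s0 st]; have [t0|t0] := eqVneq t 0; last by field.
have -> : s = 0 by apply: le_anti; rewrite s0 -t0 st.
by rewrite t0 invr0 !mulr0 subr0 addr0.
Qed.

Lemma energy_ge s t h : 0 <= s <= t -> h *+ 2 * s - h ^+ 2 * t <= s ^+ 2 / t.
Proof.
move=> st; rewrite (energyE h st) lerDl divr_ge0 ?sqr_ge0//.
by case/andP: st; exact: le_trans.
Qed.

Lemma energy_le s t : 0 <= s <= t -> s ^+ 2 / t <= t.
Proof.
move=> /andP[s0 st]; have [->|t0] := eqVneq t 0; first by rewrite invr0 mulr0.
have tgt0 : 0 < t by rewrite lt0r t0 (le_trans s0).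
by rewrite ler_pdivrMr// -expr2 ler_sqr ?nnegrE// ltW.
Qed.

Lemma ratio_itv s t : 0 <= s <= t -> 0 <= s / t <= 1.
Proof.
move=> /andP[s0 st]; rewrite divr_ge0 ?(le_trans s0)//=.
have [->|t0] := eqVneq t 0; first by rewrite invr0 mulr0.
by rewrite ler_pdivrMr ?mul1r// lt0r t0 (le_trans s0).
Qed.

(** With the ratio held fixed the right side is linear, so the energy of a coarse cell can be
    distributed over its pieces. *)
Lemma ratio_energy s t : 0 <= s <= t ->
  s ^+ 2 / t = (s / t) *+ 2 * s - (s / t) ^+ 2 * t.
Proof.
move=> /andP[s0 st]; have [->|t0] := eqVneq t 0; last by field.
by rewrite invr0 !mulr0 mul0rn mul0r subr0.
Qed.

Lemma energy_amgm s t h (l : R) : 0 <= s <= t -> 0 < l ->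
  `|s - h * t| *+ 2 <= (s - h * t) ^+ 2 / t / l + l * t.
Proof.
move=> /andP[s0 st] l0; have [t0|t0] := eqVneq t 0.
  have -> : s = 0 by apply: le_anti; rewrite s0 -t0 st.
  by rewrite t0 invr0 !mulr0 mul0r subr0 normr0 mul0rn addr0.
have tgt0 : 0 < t by rewrite lt0r t0 (le_trans s0).
rewrite -(real_normK (num_real (s - h * t))); move: `|_| => d.
rewrite -subr_ge0 (_ : _ - _ = (d - l * t) ^+ 2 / (l * t)); last first.
  by field; rewrite t0 lt0r_neq0.
by rewrite divr_ge0 ?sqr_ge0// mulr_ge0// ltW.
Qed.

Variables (I J : finType) (s t : I * bool -> J * bool -> R).
Hypothesis st : forall p q, 0 <= s p q <= t p q.

Let coarse (g : I * bool -> J * bool -> R) i j :=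
  \sum_(b : bool) \sum_(c : bool) g (i, b) (j, c).

Let energy_split (g : I * bool -> J * bool -> R) :
  \sum_p \sum_q g p q = \sum_i \sum_j coarse g i j.
Proof.
rewrite (eq_bigr (fun p => \sum_j \sum_c g (p.1, p.2) (j, c))); last first.
  by move=> [i b] _; rewrite [RHS]pair_bigA; apply: eq_bigr => -[].
rewrite -(pair_bigA _ (fun i b => \sum_j \sum_c g (i, b) (j, c))).
by apply: eq_bigr => i _; rewrite exchange_big.
Qed.

Lemma coarse_itv i j : 0 <= coarse s i j <= coarse t i j.
Proof.
apply/andP; split.
  by apply: sumr_ge0 => b _; apply: sumr_ge0 => c _; case/andP: (st (i, b) (j, c)).
by apply: ler_sum => b _; apply: ler_sum => c _; case/andP: (st (i, b) (j, c)).
Qed.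

(** Each cell is cut into four pieces, over which the coarse energy is the sum of the linear
    expressions at the coarse ratio [h]. Three pieces have at least that energy; the piece
    [(true, true)] exceeds it by [(s - h * t) ^+ 2 / t], which [energy_amgm] turns into a bound on
    the absolute value of [s - h * t]. *)
Lemma energy_gain (l : R) (h : I -> J -> R) : 0 < l ->
  (forall i j, h i j = coarse s i j / coarse t i j) ->
  (\sum_i \sum_j `|s (i, true) (j, true) - h i j * t (i, true) (j, true)|) *+ 2 <=
  (\sum_p \sum_q s p q ^+ 2 / t p q -
   \sum_i \sum_j coarse s i j ^+ 2 / coarse t i j) / l +
  l * \sum_p \sum_q t p q.
Proof.
move=> l0 hE; rewrite !energy_split -sumrB mulr_suml mulr_sumr -big_split.
rewrite -sumrMnl; apply: ler_sum => i _.
rewrite -sumrB mulr_suml mulr_sumr -big_split -sumrMnl; apply: ler_sum => j _ /=.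
set d := _ - _ * _; set g := _ / l; set tt := coarse t i j.
apply: le_trans (energy_amgm (h i j) (st _ _) l0) _; apply: lerD; last first.
  rewrite ler_wpM2l ?(ltW l0)// /tt /coarse !big_bool /=.
  have t0 p q : 0 <= t p q by case/andP: (st p q); exact: le_trans.
  by rewrite -addrA lerDl !addr_ge0.
rewrite ler_wpM2r ?invr_ge0 ?(ltW l0)//.
rewrite (ratio_energy (coarse_itv i j)) -hE /tt /coarse !big_bool /=.
have := energyE (h i j) (st (i, true) (j, true)).
have := energy_ge (h i j) (st (i, true) (j, false)).
have := energy_ge (h i j) (st (i, false) (j, true)).
have := energy_ge (h i j) (st (i, false) (j, false)).
move: (s _ _ ^+ 2 / t _ _) (s _ _ ^+ 2 / t _ _) => q1 q2.
move: (s _ _ ^+ 2 / t _ _) (s _ _ ^+ 2 / t _ _) (d ^+ 2 / _) => q3 q4 q5.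
by lra.
Qed.

End Energy.

(** * Domination on order intervals *)

Section DominatedOrderIntervals.
Context {R : realType} {E F : banachLatticeType R}.
Variables (S T : {linear E -> F}) (u : E) (phi : {scalar F}).
Hypotheses (S0 : positive_operator S) (ST : operator_le S T).
Hypotheses (u0 : 0 <= u) (phi0 : positive_functional phi).

Let dominated (a : E) (f : {scalar F}) :
  0 <= a -> positive_functional f -> 0 <= f (S a) <= f (T a).
Proof.
by move=> a0 f0; rewrite f0 ?S0//= positive_functional_le// ST.
Qed.

(* The discrete analogue of approximating the Radon-Nikodym density of the
   bimeasure of S with respect to that of T by a step function h: partitions
   (a, b) almost maximizing the energy \sum s_ij ^ 2 / t_ij can be refined only
   with a small gain of energy, which bounds the error. *)
Lemma approximating_partition (e : R) : 0 < e ->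
  exists (I J : finType) (a : I -> E) (b : J -> {scalar F}) (h : I -> J -> R),
  [/\ (forall i, 0 <= a i) /\ \sum_i a i = u,
      (forall j, positive_functional (b j)) /\ (forall z, \sum_j b j z = phi z),
      forall i j, 0 <= h i j <= 1 &
      forall (x : I -> E) (f : J -> {scalar F}),
        (forall i, 0 <= x i <= a i) ->
        (forall j z, 0 <= z -> 0 <= f j z <= b j z) ->
        \sum_i \sum_j `|f j (S (x i)) - h i j * f j (T (x i))| <= e].
Proof.
move=> e0; pose C := phi (T u).
pose partition (I J : finType) (a : I -> E) (b : J -> {scalar F}) :=
  [/\ forall i, 0 <= a i, \sum_i a i = u,
      forall j, positive_functional (b j) & forall z, \sum_j b j z = phi z].
pose energy (I J : finType) (a : I -> E) (b : J -> {scalar F}) :=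
  \sum_i \sum_j b j (S (a i)) ^+ 2 / b j (T (a i)).
pose energies : set R := [set r | exists (I J : finType) (a : I -> E)
  (b : J -> {scalar F}), partition I J a b /\ r = energy I J a b].
have totalT (I J : finType) a b : partition I J a b ->
    \sum_i \sum_j b j (T (a i)) = C.
  move=> [_ au _ bphi]; rewrite /C -au !raddf_sum.
  by apply: eq_bigr => i _; rewrite bphi.
have C0 : 0 <= C.
  by apply: phi0; apply: le_trans (ST u0); exact: S0.
have energies_sup : has_sup energies.
  split.
    exists (energy unit unit (fun=> u) (fun=> phi)), unit, unit.
    by exists (fun=> u), (fun=> phi); split=> //; split=> // [|z];
      rewrite big_const card_unit /= addr0.
  exists C => _ [I [J [a [b [ab ->]]]]]; rewrite -(totalT _ _ _ _ ab).
  have [a0 _ b0 _] := ab.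
  apply: ler_sum => i _; apply: ler_sum => j _.
  by apply: energy_le; exact: dominated.
(* A gain below [l * e] contributes at most [e] after division by [l], and [l * C <= e]; together
   they give twice the required bound. *)
pose l := e / (C + 1).
have l0 : 0 < l by rewrite divr_gt0// ltr_wpDl.
have [_ [I [J [a [b [ab ->]]]]] supE] := sup_adherent (mulr_gt0 l0 e0) energies_sup.
have [a0 au b0 bphi] := ab.
exists I, J, a, b, (fun i j => b j (S (a i)) / b j (T (a i))).
split=> // [i j|x f xa fb]; first by apply: ratio_itv; exact: dominated.
(* [x] and [f] cut each [a i] and each [b j] in two. The result is again a partition, so its energy
   is at most the supremum. *)
pose a' (p : I * bool) := if p.2 then x p.1 else a p.1 - x p.1.
pose b' (q : J * bool) : {scalar F} :=
  if q.2 then f q.1 else (b q.1 \- f q.1)%R.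
have b'E q z : b' q z = if q.2 then f q.1 z else b q.1 z - f q.1 z.
  by rewrite /b'; case: ifP.
have ab' : partition (I * bool)%type (J * bool)%type a' b'.
  split=> [[i []]||[j []] z z0|z]; rewrite ?b'E /=.
  - by case/andP: (xa i).
  - by rewrite bl_subr_ge0; case/andP: (xa i).
  - rewrite -au -(pair_bigA _ (fun i c => a' (i, c))) /=; apply: eq_bigr => i _.
    by rewrite big_bool /a' /= addrC subrK.
  - by case/andP: (fb j z z0).
  - by rewrite subr_ge0; case/andP: (fb j z z0).
  - rewrite -bphi -(pair_bigA _ (fun j c => b' (j, c) z)) /=.
    apply: eq_bigr => j _; rewrite big_bool !b'E /= addrC subrK.
    by [].
have [a'0 _ b'0 _] := ab'.
have st p q : 0 <= b' q (S (a' p)) <= b' q (T (a' p)) by exact: dominated.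
have coarseE (U : {linear E -> F}) i j :
    \sum_(c : bool) \sum_(d : bool) b' (j, d) (U (a' (i, c))) = b j (U (a i)).
  rewrite !big_bool /a' !b'E /= raddfB /= !raddfB /=.
  by lra.
have := energy_gain st l0 (h := fun i j => b j (S (a i)) / b j (T (a i))).
rewrite (totalT _ _ _ _ ab').
under eq_bigr do under eq_bigr do rewrite !b'E /=.
move=> gain; rewrite -(ler_pMn2r (n := 2))//; apply: le_trans (gain _) _.
  by move=> i j; rewrite !coarseE.
under [X in _ - X]eq_bigr do under eq_bigr do rewrite !coarseE.
rewrite mulr2n; apply: lerD; last first.
  rewrite /l mulrAC ler_pdivrMr ?ltr_wpDl// ler_wpM2l ?(ltW e0)//.
  by rewrite lerDl.
have ub : energy (I * bool)%type (J * bool)%type a' b' <= sup energies.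
  apply: sup_upper_bound energies_sup _ _.
  by exists (I * bool)%type, (J * bool)%type, a', b'.
rewrite ler_pdivrMr// lerBlDl -lerBlDr; apply: le_trans (ltW supE).
by rewrite [e * l]mulrC lerD2r.
Qed.

(** Split [x] into pieces below the [a i] and colour it by the colours of all pieces. The value of
    [phi] at a positive part is a sum of values of functionals [f j] below [b j]; there [S] may be
    replaced by [h i j] times [T], and [T] hardly separates pieces of equal colour. *)
Lemma dominated_totally_bounded (M : R) : (forall z, `|phi z| <= M * `|z|) ->
  totally_bounded [set x | 0 <= x <= u] (fun x y => `|T x - T y|) ->
  totally_bounded [set x | 0 <= x <= u] (fun x y => phi (modulus (S x - S y))).
Proof.
(* Six errors: three each for the positive and the negative part of [S x - S y]. *)
move=> phiM tbT e e0; pose e' := e / 6.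
have e'0 : 0 < e' by rewrite divr_gt0.
have [I [J [a [b [h [[a0 au] [b0 bphi] h01 happrox]]]]]] := approximating_partition e'0.
(* Chosen so that [#|I|] terms of size at most [Num.max M 0 * d] add up to less than [e']. *)
pose d := e' / (#|I|%:R * Num.max M 0 + 1).
have M0 : 0 <= Num.max M 0 by rewrite le_max lexx orbT.
have IM0 : 0 < #|I|%:R * Num.max M 0 + 1 by rewrite ltr_wpDl// mulr_ge0.
have d0 : 0 < d by rewrite divr_gt0.
have [K [c cP]] := tbT _ d0.
have /choice[X XP] (x : E) : exists y : I -> E, 0 <= x <= u ->
    (forall i, 0 <= y i <= a i) /\ x = \sum_i y i.
  have [/andP[x0 xu]|nx] := boolP (0 <= x <= u); last by exists (fun=> 0).
  rewrite -au in xu.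
  by have [y ya xy] := riesz_decomposition_sum a0 x0 xu; exists y.
have aiu i : a i <= u by rewrite -au (bigD1 i)//= bl_lerDl// bl_sumr_ge0.
exists {ffun I -> K}, (fun x => [ffun i => c (X x i)]).
suff half x y : 0 <= x <= u -> 0 <= y <= u ->
    [ffun i => c (X x i)] = [ffun i => c (X y i)] :> {ffun I -> K} ->
    phi (pos (S x - S y)) < e' + e' + e'.
  move=> x y xu yu cxy; rewrite modulusE raddfD /= opprB.
  have := half _ _ xu yu cxy; have := half _ _ yu xu (esym cxy).
  by rewrite /e'; lra.
move=> xu yu cxy; have [Xa xE] := XP _ xu; have [Ya yE] := XP _ yu.
have wd i : `|T (X x i) - T (X y i)| < d.
  apply: cP => /=.
  - by have /andP[-> Xai] := Xa i; exact: le_trans (aiu i).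
  - by have /andP[-> Yai] := Ya i; exact: le_trans (aiu i).
  - by move/ffunP/(_ i): cxy; rewrite !ffunE.
(* [f j] attains the value [b j (pos (S x - S y))] at [S x - S y]. *)
have /choice[f fP] (j : J) := dominated_functional (S x - S y) (b0 j).
have fb j z : 0 <= z -> 0 <= f j z <= b j z by exact: (fP j).1.
have f_le j z : `|f j z| <= b j (modulus z).
  have fpos : positive_functional (f j) by move=> t /(fb j)/andP[].
  have /andP[_ fbz] := fb j _ (modulus_ge0 z); apply: le_trans fbz.
  rewrite ler_norml lerNl -raddfN.
  by rewrite !positive_functional_le// ?modulus_ge ?modulus_geN.
pose err (Z : I -> E) := \sum_i \sum_j `|f j (S (Z i)) - h i j * f j (T (Z i))|.
pose w i := T (X x i) - T (X y i).
have -> : phi (pos (S x - S y)) = \sum_i \sum_j f j (S (X x i) - S (X y i)).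
  rewrite -bphi exchange_big; apply: eq_bigr => j _ /=.
  by rewrite -(fP j).2 -raddf_sum sumrB -!raddf_sum -xE -yE.
have : \sum_i \sum_j f j (S (X x i) - S (X y i)) <=
    err (X x) + err (X y) + \sum_i phi (modulus (w i)).
  rewrite -!big_split; apply: ler_sum => i _ /=.
  rewrite -bphi -!big_split; apply: ler_sum => j _ /=.
  have hw : h i j * f j (w i) <= b j (modulus (w i)).
    apply: le_trans (ler_norm _) _; apply: le_trans (f_le j (w i)).
    have /andP[h0 h1] := h01 i j.
    by rewrite normrM ger0_norm// ler_piMl.
  move: hw; rewrite /w !raddfB /=.
  have := ler_norm (f j (S (X x i)) - h i j * f j (T (X x i))).
  have := lerNnormlW (lexx `|f j (S (X y i)) - h i j * f j (T (X y i))|).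
  by lra.
move=> /le_lt_trans; apply; apply: ler_ltD; first by rewrite lerD ?happrox.
apply: le_lt_trans (_ : _ <= #|I|%:R * (Num.max M 0 * d)) _.
  rewrite mulr_natl -sumr_const; apply: ler_sum => i _.
  apply: le_trans (ler_norm _) _; apply: le_trans (phiM _) _.
  rewrite norm_modulus; apply: le_trans (ler_wpM2r (normr_ge0 _) (_ : _ <= Num.max M 0)) _.
    by rewrite le_max lexx.
  by apply: ler_wpM2l => //; exact: ltW (wd i).
rewrite mulrA /d mulrCA gtr_pMr// ltr_pdivrMr// mul1r ltrDl.
exact: ltr01.
Qed.

End DominatedOrderIntervals.

(** * Composition of dominated operators *)

Section DominatedComposition.
Context {R : realType} {E F G : banachLatticeType R}.
Variables (S1 T1 : {linear E -> F}) (S2 T2 : {linear F -> G}).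
Hypotheses (S10 : positive_operator S1) (S20 : positive_operator S2).
Hypotheses (DT1 : DW_compact T1) (DT2 : DW_compact T2).
Hypotheses (ST1 : operator_le S1 T1) (ST2 : operator_le S2 T2).

Let T10 : positive_operator T1.
Proof. by move=> x x0; apply: le_trans (ST1 x0); exact: S10. Qed.

Let T20 : positive_operator T2.
Proof. by move=> x x0; apply: le_trans (ST2 x0); exact: S20. Qed.

Lemma dominated_comp_interval (u : E) : 0 <= u ->
  totally_bounded [set x | 0 <= x <= u] (fun x y => `|S2 (S1 x) - S2 (S1 y)|).
Proof.
move=> u0 e e0; have e20 : 0 < e / 2 by rewrite divr_gt0.
have v0 : 0 <= S1 u by exact: S10.
have tbT2 := DW_compact_totally_bounded DT2 (disjointly_weakly_compact_interval v0).
have tbT1 := DW_compact_totally_bounded DT1 (disjointly_weakly_compact_interval u0).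
have [|f [f0 [M fM] fP]] := positive_functional_controls e20 _ tbT2.
  by move=> x /= /andP[/T20].
have hlin : scalar (fun x => f (T2 x)) by move=> r x y; rewrite !linearP.
pose phi : {scalar F} :=
  HB.pack (fun x => f (T2 x)) (GRing.isLinear.Build R F R *%R _ hlin).
have phi0 : positive_functional phi by move=> x /T20/f0.
have [[N T2N] _] := DT2.
have phiM z : `|phi z| <= `|M| * N * `|z|.
  apply: le_trans (fM _) _; rewrite -mulrA.
  by rewrite (le_trans (ler_wpM2r _ (ler_norm M)))// ler_wpM2l.
have [I [c cP]] := dominated_totally_bounded S10 ST1 u0 phi0 phiM tbT1 e20.
exists I, c => x y xu yu cxy; rewrite -raddfB.
apply: le_lt_trans (positive_operator_norm _ S20 ST2) _.
rewrite [ltRHS](_ : e = (e / 2) *+ 2); last by rewrite mulr2n -splitr.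
(* [S1 x] and [S1 y] lie between 0 and [S1 u], hence so does the modulus of their difference. *)
apply: fP (cP _ _ xu yu cxy) => /=; rewrite modulus_ge0/=.
have S1u z : 0 <= z <= u -> 0 <= S1 z <= S1 u.
  by move=> /andP[z0 zu]; rewrite S10// positive_operator_le.
by apply: modulusB_le; exact: S1u.
Qed.

Lemma dominated_comp_bounded : bounded_operator (S2 \o S1).
Proof.
have [[[M1 T1M] _] [[M2 T2M] _]] := (DT1, DT2).
exists (`|M2| * M1) => x /=; apply: le_trans (positive_operator_norm _ S20 ST2) _.
apply: le_trans (T2M _) _; rewrite norm_modulus -mulrA.
apply: (@le_trans _ _ (`|M2| * `|S1 x|)); first by rewrite ler_wpM2r// ler_norm.
rewrite ler_wpM2l//; apply: le_trans (positive_operator_norm _ S10 ST1) _.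
by apply: le_trans (T1M _) _; rewrite norm_modulus.
Qed.

Lemma dominated_comp_DW_compact : DW_compact (S2 \o S1).
Proof.
split=> [|A dA]; first exact: dominated_comp_bounded.
apply: totally_bounded_precompact => e e0 /=.
have [[N T2N] _] := DT2.
(* Two tails and one truncated difference, for the positive and for the negative parts, make six
   errors. *)
pose e1 := e / 8; have e10 : 0 < e1 by rewrite divr_gt0.
have N0 : 0 < `|N| + 1 by rewrite ltr_wpDl.
have [u u0 uA] := DW_compact_almost_order_bounded T10 DT1 dA (divr_gt0 e10 N0).
have [I [c cP]] := dominated_comp_interval u0 e10.
(* [tr z] is the meet of [pos z] and [u]. *)
pose tr (z : E) := pos z - pos (pos z - u).
have tru z : 0 <= tr z <= u.
  rewrite bl_subr_ge0 pos_le ?pos_ge0 ?bl_gerDl//=.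
  by rewrite bl_lerBlDr addrC -bl_lerBlDr pos_ge.
pose P z := S2 (S1 z).
have PB y z : P (y - z) = P y - P z by rewrite /P !raddfB.
have tail x : Sol A x -> `|P (pos x) - P (tr x)| < e1.
  move=> Ax; rewrite -PB opprB addrC subrK.
  have : `|T1 (pos (pos x - u))| < e1 / (`|N| + 1).
    apply: uA (pos_ge0 _); apply: Sol_idem; exists x => //.
    exact: modulus_pos_le.
  rewrite ltr_pdivlMr// mulrC; apply: le_lt_trans.
  apply: le_trans (positive_operator_norm _ S20 ST2) _.
  apply: le_trans (T2N _) _; rewrite norm_modulus.
  apply: (@le_trans _ _ ((`|N| + 1) * `|S1 (pos (pos x - u))|)).
    by rewrite ler_wpM2r// (le_trans (ler_norm N))// lerDl.
  rewrite ler_wpM2l ?(ltW N0)//.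
  by apply: le_trans (positive_operator_norm _ S10 ST1) _; rewrite modulus_id ?pos_ge0.
have ASol x : A x -> Sol A x by exists x.
have ANSol x : A x -> Sol A (- x) by exists x => //; rewrite modulusN.
have pos_close x y : Sol A x -> Sol A y -> c (tr x) = c (tr y) ->
    `|P (pos x) - P (pos y)| < e1 + e1 + e1.
  move=> Ax Ay cxy; have trc := cP _ _ (tru x) (tru y) cxy.
  have -> : P (pos x) - P (pos y) =
      P (pos x) - P (tr x) + (P (tr x) - P (tr y)) + (P (tr y) - P (pos y)).
    by rewrite !addrA !subrK.
  apply: le_lt_trans (ler_normD _ _) _; rewrite ltrD//; last by rewrite distrC tail.
  by apply: le_lt_trans (ler_normD _ _) _; rewrite ltrD// tail.
exists (I * I)%type, (fun x => (c (tr x), c (tr (- x)))) => x y Ax Ay [cp cn].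
have -> : S2 (S1 x) - S2 (S1 y) =
    P (pos x) - P (pos y) - (P (pos (- x)) - P (pos (- y))).
  by rewrite -[S2 _]/(P x) -[S2 (S1 y)]/(P y) -{1}(posB x) -{1}(posB y) !PB !opprD
    !opprK addrACA.
apply: le_lt_trans (ler_normB _ _) _.
have := pos_close _ _ (ASol _ Ax) (ASol _ Ay) cp.
have := pos_close _ _ (ANSol _ Ax) (ANSol _ Ay) cn.
rewrite /e1; move: e0; lra.
Qed.

End DominatedComposition.

Theorem corollary2p14 (R : realType) :
  (forall (E F G : banachLatticeType R)
      (S1 : {linear E -> F}) (S2 : {linear F -> G}),
    positive_operator S1 -> positive_operator S2 ->
    (exists T1 : {linear E -> F},
      [/\ positive_operator T1, DW_compact T1 & operator_le S1 T1]) ->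
    (exists T2 : {linear F -> G},
      [/\ positive_operator T2, DW_compact T2 & operator_le S2 T2]) ->
    DW_compact (S2 \o S1)) /\
  (forall (E : banachLatticeType R) (S : {linear E -> E}),
    positive_operator S ->
    (exists T : {linear E -> E}, DW_compact T /\ operator_le S T) ->
    DW_compact (S \o S)).
Proof.
split=> [E F G S1 S2 S10 S20 [T1 [_ DT1 ST1]] [T2 [_ DT2 ST2]]|E S S0 [T [DT ST]]].
  exact: (dominated_comp_DW_compact S10 S20 DT1 DT2 ST1 ST2).
exact: (dominated_comp_DW_compact S0 S0 DT DT ST ST).
Qed.
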